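(* Let $(M^4,g)$ be a perfect fluid spacetime with torse-forming vector field $\xi$. If it admits a Ricci soliton $(g,V,\Lambda)$, then either the spacetime has equal associated scalars (that is, $a=b$, so that $S(X,Y)=\kappa(\sigma+\rho)\{g(X,Y)+\eta(X)\eta(Y)\}$) and the Ricci soliton is not steady, or the Ricci soliton is expanding (or shrinking) according as $\frac{\kappa(\sigma+3\rho)}{2}>\lambda$ (or $\frac{\kappa(\sigma+3\rho)}{2}<\lambda$).
   Context: A perfect fluid spacetime with torse-forming vector field $\xi$ is a connected 4-dimensional manifold $M^4$ with a Lorentzian metric $g$ of signature $(-,+,+,+)$, Levi-Civita connection $\nabla$, and a vector field $\xi$ with $g(\xi,\xi)=-1$ and dual 1-form $\eta(X)=g(X,\xi)$, such that: (i) Einstein's equation $S(X,Y)+(\lambda-\frac r2)g(X,Y)=\kappa T(X,Y)$ holds with $T(X,Y)=\rho g(X,Y)+(\sigma+\rho)\eta(X)\eta(Y)$, where $S$ is the Ricci tensor, $r$ the scalar curvature, $\lambda$ the cosmological constant, $\kappa$ the gravitational constant (which can be taken as $8\pi G$, with $G$ the universal gravitational constant), $\sigma$ the energy density and $\rho$ the isotropic pressure; and (ii) $\nabla_X\xi=X+\eta(X)\xi$ for all vector fields $X$. Consequently $S(X,Y)=a\,g(X,Y)+b\,\eta(X)\eta(Y)$ with associated scalars $a=\lambda+\frac{\kappa(\sigma-\rho)}2$, $b=\kappa(\sigma+\rho)$. A Ricci soliton $(g,V,\Lambda)$ consists of a vector field $V$ and a constant $\Lambda$ with $(L_Vg)(X,Y)+2S(X,Y)+2\Lambda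 g(X,Y)=0$ for all $X,Y$, $L_V$ being the Lie derivative; it is shrinking, steady or expanding according as $\Lambda<0$, $\Lambda=0$ or $\Lambda>0$. Curvature convention: $R(X,Y)Z=\nabla_X\nabla_YZ-\nabla_Y\nabla_XZ-\nabla_{[X,Y]}Z$ and $S(Y,Z)$ is the trace of $X\mapsto R(X,Y)Z$. *)

(* Defs.v *)
From HB Require Import structures.
From mathcomp Require Import all_boot all_order all_algebra.
From mathcomp Require Import all_classical all_reals all_analysis.
From mathcomp Require Import ring.
Set Implicit Arguments.
Unset Strict Implicit.
Unset Printing Implicit Defensive.
Import Order.TTheory GRing.Theory Num.Theory.
Import numFieldNormedType.Exports.
Local Open Scope classical_set_scope.
Local Open Scope ring_scope.

Section Ck.
Context {R : realType} {n : nat}.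
Implicit Types (U : set 'rV[R]_n) (f g : 'rV[R]_n -> R).

(* f is C^k on the open set U: all iterated partial derivatives of order at
   most k exist and are continuous at every point of U. *)
Fixpoint Ck (k : nat) U f : Prop :=
  (forall x, U x -> {for x, continuous f}) /\
  match k with
  | 0 => True
  | k'.+1 => forall i : 'I_n,
      (forall x, U x -> derivable f x (delta_mx 0 i)) /\
      Ck k' U (fun x => 'D_(delta_mx 0 i) f x)
  end.

Definition smooth_on U f := forall k, Ck k U f.

Let continuous_at_eq U f g x : open U -> (forall y, U y -> f y = g y) ->
  U x -> {for x, continuous f} -> {for x, continuous g}.
Proof.
move=> oU fg Ux cf.
have nfg : {near x, f =1 g}.
  by apply: filterS (open_nbhs_nbhs (conj oU Ux)) => y Uy; rewrite fg.
rewrite /prop_for /continuous_at -(fg x Ux).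
exact: cvg_trans (near_eq_cvg nfg) cf.
Qed.

Lemma Ck_eq k U f g : open U -> (forall x, U x -> f x = g x) ->
  Ck k U f -> Ck k U g.
Proof.
move=> oU; elim: k f g => [|k IH] f g fg [cf df].
  by split=> // x Ux; exact: (continuous_at_eq oU fg Ux (cf x Ux)).
split=> [x Ux|]; first exact: (continuous_at_eq oU fg Ux (cf x Ux)).
move=> i; have [dfi cfi] := df i; split=> [x Ux|].
  apply: near_eq_derivable (dfi x Ux).
  by apply: filterS (open_nbhs_nbhs (conj oU Ux)) => y Uy; rewrite fg.
apply: IH cfi => x Ux; apply: near_eq_derive.
by apply: filterS (open_nbhs_nbhs (conj oU Ux)) => y Uy; rewrite fg.
Qed.

Lemma CkW k U f : Ck k.+1 U f -> Ck k U f.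
Proof.
elim: k f => [|k IH] f [cf df]; first by split.
by split=> // i; have [? /IH] := df i.
Qed.

Lemma Ck_cst k U (a : R) : Ck k U (cst a).
Proof.
elim: k a => [|k IH] a; first by split=> // x _; exact: cst_continuous.
split=> [x _|i]; first exact: cst_continuous.
split=> [x _|]; first exact: derivable_cst.
rewrite (_ : (fun x => _) = cst 0) //.
by apply/funext => x; rewrite derive_cst.
Qed.

Lemma CkB k U f g : open U -> Ck k U f -> Ck k U g -> Ck k U (f - g).
Proof.
move=> oU; elim: k f g => [|k IH] f g [cf df] [cg dg].
  by split=> // x Ux; apply: continuousB; [exact: cf|exact: cg].
split=> [x Ux|i].
  by apply: continuousB; [exact: cf|exact: cg].
have [dfi cfi] := df i; have [dgi cgi] := dg i.
split=> [x Ux|]; first by apply: derivableB; [exact: dfi|exact: dgi].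
apply: (Ck_eq oU _ (IH _ _ cfi cgi)) => x Ux.
by rewrite deriveB //; [exact: dfi|exact: dgi].
Qed.

Lemma CkM k U f g : open U -> Ck k U f -> Ck k U g -> Ck k U (f * g).
Proof.
move=> oU; elim: k f g => [|k IH] f g Cf Cg.
  case: Cf Cg => cf _ [cg _]; split=> // x Ux.
  by apply: continuousM; [exact: cf|exact: cg].
have Cf' := CkW Cf; have Cg' := CkW Cg.
case: Cf Cg => cf df [cg dg]; split=> [x Ux|i].
  by apply: continuousM; [exact: cf|exact: cg].
have [dfi cfi] := df i; have [dgi cgi] := dg i.
split=> [x Ux|]; first by apply: derivableM; [exact: dfi|exact: dgi].
have C1 := IH _ _ Cf' cgi; have C2 := IH _ _ Cg' cfi.
have C2N := CkB oU (Ck_cst k U 0) C2.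
apply: (Ck_eq oU _ (CkB oU C1 C2N)) => x Ux.
rewrite deriveM; [|exact: dfi|exact: dgi].
by rewrite !fctE sub0r opprK.
Qed.

End Ck.

Record chart (R : realType) (n : nat) (M : topologicalType) := Chart {
  chart_dom : set M;
  chart_map : M -> 'rV[R]_n;
  chart_inv : 'rV[R]_n -> M;
  chart_dom_open : open chart_dom;
  chart_im_open : open (chart_map @` chart_dom);
  chart_mapK : forall x, chart_dom x -> chart_inv (chart_map x) = x;
  chart_map_cont : forall x, chart_dom x -> {for x, continuous chart_map};
  chart_inv_cont : forall y, (chart_map @` chart_dom) y ->
    {for y, continuous chart_inv} }.

Arguments chart_dom_open {R n M} c.
Arguments chart_im_open {R n M} c.

(* The atlas need not be maximal: smoothness tested on a covering family of
   compatible charts is smoothness for the maximal atlas it generates. *)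
Record manifold (R : realType) (n : nat) := Manifold {
  mcarrier :> topologicalType;
  manifold_hausdorff : hausdorff_space mcarrier;
  manifold_second_countable : @second_countable mcarrier;
  manifold_nonempty : [set: mcarrier] !=set0;
  atlas : set (chart R n mcarrier);
  atlas_cover : forall x : mcarrier, exists2 c, atlas c & chart_dom c x;
  atlas_compat : forall c d, atlas c -> atlas d -> forall j : 'I_n,
    smooth_on (chart_map c @` (chart_dom c `&` chart_dom d))
      (fun y => chart_map d (chart_inv c y) 0 j) }.

Section Cinf.
Context {R : realType} {n : nat} (M : manifold R n).

Definition smooth : {pred M -> R} := mem [set f : M -> R |
  forall c, atlas c ->
    smooth_on (chart_map c @` chart_dom c) (f \o chart_inv c)].

Lemma smoothP (f : M -> R) : f \in smooth <->
  forall c, atlas c -> smooth_on (chart_map c @` chart_dom c) (f \o chart_inv c).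
Proof. by rewrite inE. Qed.

Lemma smooth_subring_closed : subring_closed smooth.
Proof.
split=> [|f g /smoothP sf /smoothP sg|f g /smoothP sf /smoothP sg];
  apply/smoothP => c Ac k.
- exact: Ck_cst.
- exact: (CkB (chart_im_open c) (sf c Ac k) (sg c Ac k)).
- exact: (CkM (chart_im_open c) (sf c Ac k) (sg c Ac k)).
Qed.
HB.instance Definition _ :=
  GRing.isSubringClosed.Build _ smooth smooth_subring_closed.

Lemma smooth_scaler_closed : scaler_closed smooth.
Proof.
move=> a f /smoothP sf; apply/smoothP => c Ac k.
exact: (CkM (chart_im_open c) (Ck_cst k _ a) (sf c Ac k)).
Qed.
HB.instance Definition _ :=
  GRing.isScaleClosed.Build _ _ smooth smooth_scaler_closed.

Record Cinf := MkCinf { Cinf_fun :> M -> R; _ : Cinf_fun \in smooth }.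

HB.instance Definition _ := [isSub for Cinf_fun].
HB.instance Definition _ := [Choice of Cinf by <:].
HB.instance Definition _ :=
  GRing.SubChoice_isSubComPzRing.Build _ _ Cinf (subringClosedP _).
HB.instance Definition _ := [SubZmodule_isSubLmodule of Cinf by <:].

Lemma Cinf_oner_neq0 : 1 != 0 :> Cinf.
Proof.
have [x _] := manifold_nonempty M; apply/eqP => /(congr1 Cinf_fun).
by move=> /(congr1 (@^~ x)) /eqP; rewrite oner_eq0.
Qed.
HB.instance Definition _ :=
  GRing.PzSemiRing_isNonZero.Build Cinf Cinf_oner_neq0.

Lemma Cinf_eq (f h : Cinf) : f =1 h -> f = h.
Proof. by move=> fh; apply/val_inj/funext. Qed.

End Cinf.
Arguments smooth {R n} M.

Section Tangent.
Context {R : realType} {n : nat} (M : manifold R n) (p : M).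

(* Tangent vectors are derivations at p of C^oo(M); a vector field is a
   derivation of C^oo(M), and vfield_at gives its value at a point. *)
Definition is_derivation_at (v : Cinf M -> R) : Prop :=
  (forall (a : R) f h, v (a *: f + h) = a * v f + v h) /\
  (forall f h, v (f * h) = v f * h p + f p * v h).

Definition derivation_at : {pred Cinf M -> R} :=
  mem [set v | is_derivation_at v].

Lemma derivation_atP v : v \in derivation_at <-> is_derivation_at v.
Proof. by rewrite inE. Qed.

Lemma derivation_at_submod_closed : subsemimod_closed derivation_at.
Proof.
split; first split.
- apply/derivation_atP; split=> [a f h|f h].
  + by change (0 = a * 0 + 0 :> R); rewrite mulr0 addr0.
  + by change (0 = 0 * h p + f p * 0 :> R); rewrite mul0r mulr0 addr0.
- move=> u v /derivation_atP [ul um] /derivation_atP [vl vm].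
  apply/derivation_atP; split=> [a f h|f h].
  + change (u (a *: f + h) + v (a *: f + h) = a * (u f + v f) + (u h + v h)).
    by rewrite ul vl mulrDr addrACA.
  + change (u (f * h) + v (f * h) = (u f + v f) * h p + f p * (u h + v h)).
    by rewrite um vm mulrDl mulrDr addrACA.
- move=> b v /derivation_atP [vl vm].
  apply/derivation_atP; split=> [a f h|f h].
  + change (b * v (a *: f + h) = a * (b * v f) + b * v h).
    by rewrite vl mulrDr mulrCA.
  + change (b * v (f * h) = b * v f * h p + f p * (b * v h)).
    by rewrite vm mulrDr mulrA (mulrCA b).
Qed.
HB.instance Definition _ :=
  GRing.isSubSemiModClosed.Build _ _ derivation_at derivation_at_submod_closed.

Record tangent :=
  MkTangent { tangent_fun :> Cinf M -> R; _ : tangent_fun \in derivation_at }.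

HB.instance Definition _ := [isSub for tangent_fun].
HB.instance Definition _ := [Choice of tangent by <:].
HB.instance Definition _ := [SubChoice_isSubLmodule of tangent by <:].

End Tangent.

Section VectorField.
Context {R : realType} {n : nat} (M : manifold R n).

Definition is_derivation (X : Cinf M -> Cinf M) : Prop :=
  (forall (a : R) f h, X (a *: f + h) = a *: X f + X h) /\
  (forall f h, X (f * h) = X f * h + f * X h).

Definition derivation : {pred Cinf M -> Cinf M} :=
  mem [set X | is_derivation X].

Lemma derivationP X : X \in derivation <-> is_derivation X.
Proof. by rewrite inE. Qed.

Lemma derivation_zmod_closed : zmod_closed derivation.
Proof.
split=> [|X Y /derivationP [Xl Xm] /derivationP [Yl Ym]];
  apply/derivationP; split=> [a f h|f h].
- by change (0 = a *: 0 + 0 :> Cinf M); rewrite scaler0 addr0.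
- by change (0 = 0 * h + f * 0 :> Cinf M); rewrite mul0r mulr0 addr0.
- change (X (a *: f + h) - Y (a *: f + h) = a *: (X f - Y f) + (X h - Y h)).
  by rewrite Xl Yl scalerBr opprD addrACA.
- change (X (f * h) - Y (f * h) = (X f - Y f) * h + f * (X h - Y h)).
  by rewrite Xm Ym mulrBl mulrBr opprD addrACA.
Qed.
HB.instance Definition _ :=
  GRing.isZmodClosed.Build _ derivation derivation_zmod_closed.

Record vfield := MkVfield
  { vfield_fun :> Cinf M -> Cinf M; _ : vfield_fun \in derivation }.

HB.instance Definition _ := [isSub for vfield_fun].
HB.instance Definition _ := [Choice of vfield by <:].
HB.instance Definition _ := [SubChoice_isSubZmodule of vfield by <:].

Implicit Types (f h : Cinf M) (X Y : vfield).

Lemma vfieldP X : is_derivation X.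
Proof. by apply/derivationP; case: X. Qed.

Lemma vfield_eq X Y : X =1 Y -> X = Y.
Proof. by move=> XY; apply/val_inj/funext. Qed.

Lemma scale_vfield_subproof f X : (fun h => f * X h) \in derivation.
Proof.
have [Xl Xm] := vfieldP X; apply/derivationP; split=> [a h k|h k].
- rewrite Xl mulrDr; congr (_ + _).
  by apply: Cinf_eq => x; change (f x * (a * X h x) = a * (f x * X h x));
    rewrite mulrCA.
- by rewrite Xm mulrDr mulrA (mulrCA f).
Qed.

Definition scale_vfield f X : vfield := MkVfield (scale_vfield_subproof f X).

Lemma scale_vfieldA f h X :
  scale_vfield f (scale_vfield h X) = scale_vfield (f * h) X.
Proof. by apply: vfield_eq => k; rewrite /= mulrA. Qed.

Lemma scale_vfield1 : left_id 1 scale_vfield.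
Proof. by move=> X; apply: vfield_eq => k; rewrite /= mul1r. Qed.

Lemma scale_vfieldDr : right_distributive scale_vfield +%R.
Proof.
move=> f X Y; apply: vfield_eq => k.
by change (f * (X k + Y k) = f * X k + f * Y k); rewrite mulrDr.
Qed.

Lemma scale_vfieldDl X : {morph scale_vfield^~ X : f h / f + h}.
Proof.
move=> f h; apply: vfield_eq => k.
by change ((f + h) * X k = f * X k + h * X k); rewrite mulrDl.
Qed.

HB.instance Definition _ := GRing.Zmodule_isLmodule.Build (Cinf M) vfield
  scale_vfieldA scale_vfield1 scale_vfieldDr scale_vfieldDl.

Lemma lie_bracket_subproof X Y :
  (fun f => X (Y f) - Y (X f)) \in derivation.
Proof.
have [Xl Xm] := vfieldP X; have [Yl Ym] := vfieldP Y.
have XD f h : X (f + h) = X f + X h.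
  by have := Xl 1 f h; rewrite !scale1r.
have YD f h : Y (f + h) = Y f + Y h.
  by have := Yl 1 f h; rewrite !scale1r.
apply/derivationP; split=> [a f h|f h].
- by rewrite Yl Xl Xl Yl scalerBr opprD addrACA.
- rewrite Ym Xm XD YD !Xm !Ym; ring.
Qed.

Definition lie_bracket X Y : vfield := MkVfield (lie_bracket_subproof X Y).

Lemma vfield_at_subproof X (p : M) :
  (fun f => X f p) \in derivation_at p.
Proof.
have [Xl Xm] := vfieldP X; apply/derivation_atP.
by split=> [a f h|f h]; rewrite ?Xl ?Xm.
Qed.

Definition vfield_at X p : tangent p := MkTangent (vfield_at_subproof X p).

(* The values at p of the fields E_i form a basis of the tangent space at p.
   Every tangent vector extends to a vector field on M, so every basis of the
   tangent space is of this form. *)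
Definition frame_at (p : M) (E : 'I_n -> vfield) : Prop :=
  forall v : tangent p,
    exists! c : 'rV[R]_n, v = \sum_(i < n) c 0 i *: vfield_at (E i) p.

(* t is the trace of the endomorphism of the tangent space at p induced by the
   tensorial map L. *)
Definition is_trace_at (p : M) (L : vfield -> vfield) (t : R) : Prop :=
  forall (E : 'I_n -> vfield) (A : 'M[R]_n), frame_at p E ->
    (forall i, vfield_at (L (E i)) p =
               \sum_(j < n) A i j *: vfield_at (E j) p) ->
    t = \tr A.

End VectorField.

(* Signature (-,+,...,+); a family with this nonsingular Gram matrix also
   witnesses nondegeneracy at p. *)
Record lorentz_metric (R : realType) (n : nat) (M : manifold R n) :=
  LorentzMetric {
  lmetric :> forall p : M, tangent p -> tangent p -> R;
  lmetric_sym : forall p (u v : tangent p), lmetric u v = lmetric v u;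
  lmetric_linear : forall p (a : R) (u v w : tangent p),
    lmetric (a *: u + v) w = a * lmetric u w + lmetric v w;
  lmetric_smooth : forall X Y : vfield M,
    (fun p => lmetric (vfield_at X p) (vfield_at Y p)) \in smooth M;
  lmetric_signature : forall p, exists E : 'I_n -> vfield M,
    frame_at p E /\
    forall i j, lmetric (vfield_at (E i) p) (vfield_at (E j) p) =
                if i == j then (if val i == 0%N then -1 else 1) else 0 }.

Section Geometry.
Context {R : realType} {n : nat} {M : manifold R n} (g : lorentz_metric M).
Implicit Types (f : Cinf M) (X Y Z V : vfield M).

Definition inner X Y : Cinf M := MkCinf (lmetric_smooth g X Y).

Definition is_connection (D : vfield M -> vfield M -> vfield M) : Prop :=
  [/\ forall f X Y Z, D (f *: X + Y) Z = f *: D X Z + D Y Z,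
      forall X Y Z, D X (Y + Z) = D X Y + D X Z &
      forall f X Y, D X (f *: Y) = X f *: Y + f *: D X Y].

Definition is_levi_civita (D : vfield M -> vfield M -> vfield M) : Prop :=
  [/\ is_connection D,
      forall X Y, D X Y - D Y X = lie_bracket X Y &
      forall X Y Z, X (inner Y Z) = inner (D X Y) Z + inner Y (D X Z)].

Definition curvature (D : vfield M -> vfield M -> vfield M) X Y Z : vfield M :=
  D X (D Y Z) - D Y (D X Z) - D (lie_bracket X Y) Z.

Definition is_ricci (D : vfield M -> vfield M -> vfield M)
    (S : vfield M -> vfield M -> M -> R) : Prop :=
  forall Y Z p, is_trace_at p (fun X => curvature D X Y Z) (S Y Z p).

(* r = g^{ij} S_{ij}, invmx of the Gram matrix being g^{ij}. *)
Definition is_scalar_curvature (S : vfield M -> vfield M -> M -> R)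
    (r : M -> R) : Prop :=
  forall p (E : 'I_n -> vfield M), frame_at p E ->
    r p = \tr (invmx (\matrix_(i, j) inner (E i) (E j) p)
               *m (\matrix_(i, j) S (E i) (E j) p)).

Definition lie_metric V X Y : Cinf M :=
  V (inner X Y) - inner (lie_bracket V X) Y - inner X (lie_bracket V Y).

Definition ricci_soliton (S : vfield M -> vfield M -> M -> R) V (Lam : R) :
    Prop :=
  forall X Y p, lie_metric V X Y p + 2 * S X Y p + 2 * Lam * inner X Y p = 0.

Definition dual_form (xi X : vfield M) : Cinf M := inner X xi.

Definition unit_timelike (xi : vfield M) : Prop :=
  forall p, inner xi xi p = -1.

Definition torse_forming (D : vfield M -> vfield M -> vfield M)
    (xi : vfield M) : Prop :=
  forall X, D X xi = X + dual_form xi X *: xi.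

Definition energy_momentum (xi : vfield M) (sigma rho : Cinf M) X Y (p : M) :
    R :=
  rho p * inner X Y p +
  (sigma p + rho p) * dual_form xi X p * dual_form xi Y p.

Definition einstein_equation (S : vfield M -> vfield M -> M -> R) (r : M -> R)
    (lambda kappa : R) (T : vfield M -> vfield M -> M -> R) : Prop :=
  forall X Y p,
    S X Y p + (lambda - r p / 2) * inner X Y p = kappa * T X Y p.

End Geometry.

Section AssociatedScalars.
Context {R : realType} {n : nat} {M : manifold R n}.
Implicit Types (sigma rho : Cinf M).

Definition assoc_a (lambda kappa : R) sigma rho (p : M) : R :=
  lambda + kappa * (sigma p - rho p) / 2.

Definition assoc_b (kappa : R) sigma rho (p : M) : R :=
  kappa * (sigma p + rho p).

End AssociatedScalars.

Definition expanding (R : realType) (Lam : R) : Prop := 0 < Lam.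
Definition steady (R : realType) (Lam : R) : Prop := Lam = 0.
Definition shrinking (R : realType) (Lam : R) : Prop := Lam < 0.

(* Main.v *)
Require Import Defs.
From mathcomp Require Import all_boot all_order all_algebra.
From mathcomp Require Import all_classical all_reals all_analysis.
From mathcomp Require Import ring lra.
Set Implicit Arguments.
Unset Strict Implicit.
Unset Printing Implicit Defensive.
Import Order.TTheory GRing.Theory Num.Theory.
Import numFieldNormedType.Exports.
Local Open Scope classical_set_scope.
Local Open Scope ring_scope.

(* The torse-forming equation gives R(X, Y) xi = eta(Y) X - eta(X) Y, hence
   S(xi, xi) = -3; as S = a g + b eta eta, this means a - b = 3, that is,
   lambda = 3 + kappa (sigma + 3 rho) / 2.  It remains to show Lam = -3, whatever
   the soliton field V.

   Put P = g + eta eta and k = b / 2.  On the three-dimensional complement of xi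
   the Ricci tensor determines the curvature, so that
     R(X, Y, Z, W) = g(Y, Z) g(X, W) - g(X, Z) g(Y, W)
                     + k (P(Y, Z) P(X, W) - P(X, Z) P(Y, W)),
   and the second Bianchi identity yields xi k = - 2 k.  With c = 3 + Lam the
   soliton equation reads L_V g = - 2 (2 k + c) g - 4 k eta eta.  Its
   derivative along xi gives the Hessian of f = eta(V),
     Hess f = (2 xi k - 2 c) P + 2 c eta eta + df eta + eta df,
   and differentiating this once more along xi gives
   xi (xi k) + 2 xi k = c.  Since xi k = - 2 k the left-hand side vanishes, so
   c = 0. *)

(** * Vector fields and the Levi-Civita connection *)

Section Calculus.
Context {R : realType} {n : nat} {M : manifold R n}.
Implicit Types (f h : Cinf M) (X Y Z V W : vfield M).

Lemma vfieldD X f h : X (f + h) = X f + X h.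
Proof. by have [/(_ 1 f h)] := vfieldP X; rewrite !scale1r. Qed.

Lemma vfieldM X f h : X (f * h) = X f * h + f * X h.
Proof. by have [_] := vfieldP X. Qed.

Lemma vfield0 X : X 0 = 0.
Proof. by apply: (addrI (X 0)); rewrite -vfieldD !addr0. Qed.

Lemma vfieldN X f : X (- f) = - X f.
Proof. by apply/eqP; rewrite -addr_eq0 -vfieldD addNr vfield0. Qed.

Lemma vfieldB X f h : X (f - h) = X f - X h.
Proof. by rewrite vfieldD vfieldN. Qed.

Lemma vfield1 X : X 1 = 0.
Proof.
have := vfieldM X 1 1; rewrite !mulr1 mul1r => E.
by apply: (addrI (X 1)); rewrite -E addr0.
Qed.

Lemma vfieldZ X (a : R) f : X (a *: f) = a *: X f.
Proof.
by have [/(_ a f 0)] := vfieldP X; rewrite vfield0 !addr0.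
Qed.

Lemma vfield_cst X (a : R) : X (a *: (1 : Cinf M)) = 0.
Proof. by rewrite vfieldZ vfield1 scaler0. Qed.

Lemma vfield_nat X k : X k%:R = 0.
Proof.
elim: k => [|k IH]; first exact: vfield0.
by rewrite -addn1 natrD vfieldD IH vfield1 addr0.
Qed.

Lemma add_vfieldE X Y f : (X + Y) f = X f + Y f.
Proof. by []. Qed.

Lemma opp_vfieldE X f : (- X) f = - X f.
Proof. by []. Qed.

Lemma scale_vfieldE f X h : (f *: X) h = f * X h.
Proof. by []. Qed.

Lemma lie_bracketE X Y f : lie_bracket X Y f = X (Y f) - Y (X f).
Proof. by []. Qed.

Lemma lie_bracketC X Y : lie_bracket Y X = - lie_bracket X Y.
Proof. by apply: vfield_eq => f; rewrite opp_vfieldE !lie_bracketE opprB. Qed.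

Lemma jacobi X Y Z :
  lie_bracket (lie_bracket X Y) Z + lie_bracket (lie_bracket Y Z) X
    + lie_bracket (lie_bracket Z X) Y = 0.
Proof.
apply: vfield_eq => f; rewrite !add_vfieldE !lie_bracketE !vfieldB.
by transitivity (0 : Cinf M); first ring.
Qed.

Lemma vfield_atD X Y p : vfield_at (X + Y) p = vfield_at X p + vfield_at Y p.
Proof. exact: val_inj. Qed.

Lemma vfield_atZ f X p : vfield_at (f *: X) p = f p *: vfield_at X p.
Proof. exact: val_inj. Qed.

Lemma vfield_at_eq X Y : (forall p, vfield_at X p = vfield_at Y p) -> X = Y.
Proof.
move=> XY; apply: vfield_eq => f; apply: Cinf_eq => p.
by have /(congr1 (fun v : tangent p => v f)) := XY p.
Qed.

Lemma Cinf_addE f h p : (f + h) p = f p + h p. Proof. by []. Qed.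

Lemma Cinf_oppE f p : (- f) p = - f p. Proof. by []. Qed.

Lemma Cinf_mulE f h p : (f * h) p = f p * h p. Proof. by []. Qed.

Lemma Cinf_scaleE (a : R) f p : (a *: f) p = a * f p. Proof. by []. Qed.

Lemma Cinf_natE k p : (k%:R : Cinf M) p = k%:R.
Proof. by elim: k => // k IH; rewrite -addn1 !natrD Cinf_addE IH. Qed.

Lemma Cinf_oneE p : (1 : Cinf M) p = 1. Proof. by []. Qed.

Lemma Cinf_zeroE p : (0 : Cinf M) p = 0. Proof. by []. Qed.

Definition CinfE := (Cinf_zeroE, Cinf_oneE, Cinf_addE, Cinf_oppE, Cinf_mulE,
  Cinf_scaleE, Cinf_natE).

(** Cancels the factor 2 in the ring [Cinf M]: several identities below come out as twice the wanted
    one. *)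
Lemma Cinf_double_eq0 f : f + f = 0 -> f = 0.
Proof.
move=> /(congr1 (fun h : Cinf M => h _)) f0; apply: Cinf_eq => p.
by have := f0 p; change (f p + f p = 0 -> f p = 0); lra.
Qed.

End Calculus.

Section Metric.
Context {R : realType} {n : nat} {M : manifold R n} (g : lorentz_metric M).
Implicit Types (f h : Cinf M) (X Y Z V W : vfield M).
Local Notation "<< X , Y >>" := (inner g X Y).

Lemma innerC X Y : << X, Y >> = << Y, X >>.
Proof. by apply: Cinf_eq => p; exact: lmetric_sym. Qed.

Lemma inner_linear f X Y Z : << f *: X + Y, Z >> = f * << X, Z >> + << Y, Z >>.
Proof.
apply: Cinf_eq => p; rewrite /inner /= vfield_atD vfield_atZ.
exact: lmetric_linear.
Qed.

Lemma innerDl X Y Z : << X + Y, Z >> = << X, Z >> + << Y, Z >>.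
Proof. by rewrite -[X]scale1r inner_linear scale1r mul1r. Qed.

Lemma inner0l Z : << 0, Z >> = 0.
Proof. by apply: (addrI << 0, Z >>); rewrite -innerDl !addr0. Qed.

Lemma innerZl f X Z : << f *: X, Z >> = f * << X, Z >>.
Proof. by rewrite -[_ *: X]addr0 inner_linear inner0l addr0. Qed.

Lemma innerNl X Z : << - X, Z >> = - << X, Z >>.
Proof. by rewrite -scaleN1r innerZl mulN1r. Qed.

Lemma innerDr X Y Z : << Z, X + Y >> = << Z, X >> + << Z, Y >>.
Proof. by rewrite innerC innerDl !(innerC _ Z). Qed.

Lemma innerZr f X Z : << Z, f *: X >> = f * << Z, X >>.
Proof. by rewrite innerC innerZl (innerC _ Z). Qed.

Lemma innerNr X Z : << Z, - X >> = - << Z, X >>.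
Proof. by rewrite innerC innerNl (innerC _ Z). Qed.

Definition innerE := (innerDl, innerDr, innerNl, innerNr, innerZl, innerZr).

End Metric.

Section LeviCivita.
Context {R : realType} {n : nat} {M : manifold R n} (g : lorentz_metric M).
Variable D : vfield M -> vfield M -> vfield M.
Hypothesis D_levi_civita : is_levi_civita g D.
Implicit Types (f h : Cinf M) (X Y Z V W : vfield M).
Local Notation "<< X , Y >>" := (inner g X Y).
Local Notation Rm X Y Z W := << curvature D X Y Z, W >>.

Lemma connDr X Y Z : D X (Y + Z) = D X Y + D X Z.
Proof. by have [[]] := D_levi_civita. Qed.

Lemma connZr f X Y : D X (f *: Y) = X f *: Y + f *: D X Y.
Proof. by have [[]] := D_levi_civita. Qed.

Lemma conn_linear f X Y Z : D (f *: X + Y) Z = f *: D X Z + D Y Z.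
Proof. by have [[]] := D_levi_civita. Qed.

Lemma connDl X Y Z : D (X + Y) Z = D X Z + D Y Z.
Proof. by rewrite -[X]scale1r conn_linear !scale1r. Qed.

Lemma conn0l Z : D 0 Z = 0.
Proof. by apply: (addrI (D 0 Z)); rewrite -connDl !addr0. Qed.

Lemma connZl f X Z : D (f *: X) Z = f *: D X Z.
Proof. by rewrite -[_ *: X]addr0 conn_linear conn0l addr0. Qed.

Lemma connNl X Z : D (- X) Z = - D X Z.
Proof. by rewrite -scaleN1r connZl scaleN1r. Qed.

Lemma connNr X Z : D X (- Z) = - D X Z.
Proof.
by apply/eqP; rewrite -addr_eq0 -connDr addNr;
   apply/eqP/(addrI (D X 0)); rewrite -connDr !addr0.
Qed.

Lemma torsion_free X Y : lie_bracket X Y = D X Y - D Y X.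
Proof. by have [_ ->] := D_levi_civita. Qed.

Lemma conn_metric X Y Z : X << Y, Z >> = << D X Y, Z >> + << Y, D X Z >>.
Proof. by have [_ _] := D_levi_civita. Qed.

Lemma lie_metricE V X Y : lie_metric g V X Y = << D X V, Y >> + << X, D Y V >>.
Proof.
by rewrite /lie_metric !torsion_free conn_metric !innerE; ring.
Qed.

(** * Symmetries of the curvature tensor and the Bianchi identities *)

Lemma curvature_vfieldE X Y Z :
  curvature D X Y Z = D X (D Y Z) - D Y (D X Z) - D (lie_bracket X Y) Z.
Proof. by []. Qed.

Lemma curvatureE X Y Z W :
  Rm X Y Z W = << D X (D Y Z), W >> - << D Y (D X Z), W >>
               - << D (lie_bracket X Y) Z, W >>.
Proof. by rewrite /curvature !innerE. Qed.

Lemma curvature_anti12 X Y Z W : Rm Y X Z W = - Rm X Y Z W.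
Proof. by rewrite !curvatureE (lie_bracketC X Y) connNl !innerE; ring. Qed.

(** Metric compatibility, applied twice to [[X, Y] <<Z, W>>], leaves the curvature terms, as mixed
    products such as [<<D X Z, D Y W>>] cancel. *)
Lemma curvature_anti34 X Y Z W : Rm X Y W Z = - Rm X Y Z W.
Proof.
have := lie_bracketE X Y << Z, W >>.
rewrite !conn_metric !vfieldD !conn_metric !curvatureE.
rewrite !(innerC g _ Z) => E.
have -> : << D (lie_bracket X Y) Z, W >> =
  << D (lie_bracket X Y) Z, W >> + << Z, D (lie_bracket X Y) W >>
  - << Z, D (lie_bracket X Y) W >> by ring.
by rewrite E; ring.
Qed.

(** Torsion-freeness turns the Jacobi identity into minus this cyclic sum. *)
Lemma bianchi1 X Y Z W : Rm X Y Z W + Rm Y Z X W + Rm Z X Y W = 0.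
Proof.
have := jacobi X Y Z.
rewrite (torsion_free (lie_bracket X Y)) (torsion_free (lie_bracket Y Z)).
rewrite (torsion_free (lie_bracket Z X)).
rewrite {2}(torsion_free X Y) {2}(torsion_free Y Z) {2}(torsion_free Z X).
rewrite !(connDr, connNr) => /(congr1 (fun V => << V, W >>)).
rewrite !curvatureE inner0l !innerE => E.
by rewrite -oppr0 -E; ring.
Qed.

(** Take the first Bianchi identity for the four cyclic shifts of the arguments. Once the
    antisymmetries have aligned equal terms, the first two minus the last two give twice the
    difference of the sides. *)
Lemma curvature_pair X Y Z W : Rm X Y Z W = Rm Z W X Y.
Proof.
have B1 := bianchi1 X Y Z W; have B2 := bianchi1 Y Z W X.
have B3 := bianchi1 Z W X Y; have B4 := bianchi1 W X Y Z.
rewrite (curvature_anti34 Y Z X W) (curvature_anti34 Z W X Y) in B2.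
rewrite (curvature_anti12 Y W) in B2.
rewrite (curvature_anti12 X W) (curvature_anti34 X W Y Z) in B3.
rewrite (curvature_anti12 Z X) (curvature_anti34 Z X Y W) in B3.
rewrite (curvature_anti12 X W) (curvature_anti34 X Y Z W) in B4.
rewrite (curvature_anti34 Y W Z X) in B4.
apply/eqP; rewrite -subr_eq0; apply/eqP/Cinf_double_eq0.
transitivity (0 + 0 - 0 - 0 : Cinf M); last by rewrite !subr0 addr0.
by rewrite -{1}B1 -{1}B2 -{1}B3 -B4; ring.
Qed.

(** Each pair on the left is the commutator of [D X] with the operator [curvature D Y Z], so the
    Jacobi identities for operators and for vector fields apply. The terms in [D X Y] of the
    covariant derivative of the curvature are gathered, by torsion-freeness, into the brackets on
    the right. *)
Lemma bianchi2 X Y Z W U :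
  << D X (curvature D Y Z W), U >> - Rm Y Z (D X W) U
  + (<< D Y (curvature D Z X W), U >> - Rm Z X (D Y W) U)
  + (<< D Z (curvature D X Y W), U >> - Rm X Y (D Z W) U) =
  Rm (lie_bracket X Y) Z W U + Rm (lie_bracket Y Z) X W U
  + Rm (lie_bracket Z X) Y W U.
Proof.
have := jacobi X Y Z.
move=> /(congr1 (fun V => << D V W, U >>)).
rewrite !connDl conn0l inner0l !innerE => J.
rewrite /curvature !(connDr, connNr) !innerE.
set L := LHS; rewrite -[L]subr0 -J {}/L; ring.
Qed.

End LeviCivita.

(** * Orthonormal frames *)

Section Frames.
Context {R : realType} {n : nat} {M : manifold R n} (g : lorentz_metric M).
Implicit Types (f h : Cinf M) (X Y Z V W : vfield M) (E F : 'I_n -> vfield M).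
Local Notation "<< X , Y >>" := (inner g X Y).

Definition lorentz_sign (i : 'I_n) : R := if val i == 0%N then -1 else 1.
Local Notation eps := lorentz_sign.

Lemma lorentz_sign_sqr i : eps i * eps i = 1.
Proof. by rewrite /lorentz_sign; case: ifP => _; rewrite ?mulrNN mulr1. Qed.

Definition orthonormal_at (p : M) E : Prop :=
  forall i j, << E i, E j >> p = if i == j then eps i else 0.

Lemma orthonormal_frame_exists p :
  exists E, frame_at p E /\ orthonormal_at p E.
Proof. exact: lmetric_signature. Qed.

Lemma lmetric_suml p I (s : seq I) (c : I -> R) (u : I -> tangent p) w :
  g p (\sum_(i <- s) c i *: u i) w = \sum_(i <- s) c i * g p (u i) w.
Proof.
have g0 : g p 0 w = 0.
  have := lmetric_linear g 1 0 0 w; rewrite scaler0 addr0 mul1r => E.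
  by apply: (addrI (g p 0 w)); rewrite -E addr0.
elim: s => [|i s IH]; rewrite ?big_nil // !big_cons -IH.
exact: lmetric_linear.
Qed.

Lemma frame_expansion p E (v : tangent p) : frame_at p E ->
  orthonormal_at p E ->
  v = \sum_(i < n) (eps i * g p v (vfield_at (E i) p)) *: vfield_at (E i) p.
Proof.
move=> /(_ v)[c [vE _]] oE; rewrite {1}vE; apply: eq_bigr => i _.
congr (_ *: _); rewrite vE lmetric_suml (bigD1 i) //= big1 => [|j ji].
  by rewrite addr0 -[g p _ _]/(<< E i, E i >> p) oE eqxx mulrCA
    lorentz_sign_sqr mulr1.
by rewrite -[g p _ _]/(<< E j, E i >> p) oE (negPf ji) mulr0.
Qed.

Lemma inner_expansion p E X Y : frame_at p E -> orthonormal_at p E ->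
  << X, Y >> p = \sum_(i < n) eps i * << X, E i >> p * << Y, E i >> p.
Proof.
move=> fE oE; rewrite (innerC g X Y) {1}/inner /=.
rewrite {1}(frame_expansion (vfield_at Y p) fE oE) lmetric_suml.
apply: eq_bigr => i _; rewrite mulrAC; congr (_ * _ * _).
by rewrite lmetric_sym.
Qed.

Lemma inner_nondegenerate X Y : (forall Z, << X, Z >> = << Y, Z >>) -> X = Y.
Proof.
move=> XY; apply: vfield_at_eq => p.
have [E [fE oE]] := orthonormal_frame_exists p.
rewrite (frame_expansion (vfield_at X p) fE oE).
rewrite [RHS](frame_expansion (vfield_at Y p) fE oE); apply: eq_bigr => i _.
by congr (_ * _ *: _); have /(congr1 (fun f : Cinf M => f p)) := XY (E i).
Qed.

(** The matrix [B] of products of [F] with a known frame [E] satisfies [B J B^T J = 1]. A one-sided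
    inverse of a square matrix is two-sided, so [B^T J B J = 1], which makes the vectors of [F]
    span. *)
Lemma orthonormal_frame p F : orthonormal_at p F -> frame_at p F.
Proof.
move=> oF v; have [E [fE oE]] := orthonormal_frame_exists p.
pose J : 'M[R]_n := diag_mx (\row_i eps i).
pose B : 'M[R]_n := \matrix_(i, j) << F i, E j >> p.
have EJ k (A : 'M[R]_(k, n)) : A *m J = \matrix_(i, j) (A i j * eps j).
  by apply/matrixP => i j; rewrite mul_mx_diag !mxE.
have BB : (B *m J) *m (B^T *m J) = 1%:M.
  apply/matrixP => i j; rewrite mulmxA EJ !mxE.
  transitivity (<< F i, F j >> p * eps j); last first.
    by rewrite oF; case: eqP => [->|_]; rewrite ?mul0r // lorentz_sign_sqr.
  rewrite (inner_expansion _ _ fE oE); congr (_ * _); apply: eq_bigr => k _.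
  by rewrite EJ !mxE (mulrC (eps k)).
have {}BB := mulmx1C BB.
have vF : v = \sum_k (eps k * g p v (vfield_at (F k) p)) *: vfield_at (F k) p.
  transitivity (\sum_k (eps k * \sum_i (eps i * g p v (vfield_at (E i) p))
      * g p (vfield_at (E i) p) (vfield_at (F k) p)) *:
    \sum_j (eps j * g p (vfield_at (F k) p) (vfield_at (E j) p)) *:
      vfield_at (E j) p); last first.
    apply: eq_bigr => k _; rewrite -frame_expansion // -lmetric_suml.
    by rewrite -frame_expansion.
  under [RHS]eq_bigr do rewrite scaler_sumr.
  rewrite {1}(frame_expansion v fE oE).
  rewrite exchange_big /=; apply: eq_bigr => j _.
  under [RHS]eq_bigr do rewrite scalerA.
  rewrite -scaler_suml; congr (_ *: _).
  pose w : 'rV[R]_n := \row_i (eps i * g p v (vfield_at (E i) p)).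
  move: BB => /(congr1 (mulmx w))/rowP/(_ j).
  rewrite mulmx1 !mulmxA EJ !mxE => <-; rewrite mulr_suml.
    apply: eq_bigr => k _; rewrite EJ !mxE.
  rewrite (mulrC (eps j)) mulrA; congr (_ * _ * _).
  rewrite mulrC; congr (_ * _); apply: eq_bigr => i _.
  by rewrite !mxE; congr (_ * _); rewrite lmetric_sym.
exists (\row_k (eps k * g p v (vfield_at (F k) p))); split.
  by rewrite {1}vF; apply: eq_bigr => k _; rewrite mxE.
move=> c vc; apply/rowP => k; rewrite mxE vc lmetric_suml (bigD1 k) //= big1.
  by rewrite -[g p _ _]/(<< F k, F k >> p) oF eqxx addr0 mulrCA
    lorentz_sign_sqr mulr1.
move=> i ik.
by rewrite -[g p _ _]/(<< F i, F k >> p) oF (negPf ik) mulr0.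
Qed.

Lemma ricci_orthonormal D S p E Y Z : is_ricci D S -> orthonormal_at p E ->
  S Y Z p = \sum_i eps i * << curvature D (E i) Y Z, E i >> p.
Proof.
move=> ric oE; have fE := orthonormal_frame oE.
pose A := \matrix_(i, j) (eps j * << curvature D (E i) Y Z, E j >> p).
rewrite (ric Y Z p E A fE); first by apply: eq_bigr => i _; rewrite mxE.
move=> i; rewrite {1}(frame_expansion (vfield_at _ p) fE oE).
by apply: eq_bigr => j _; rewrite mxE.
Qed.

Lemma scalar_curvature_orthonormal S r p E : is_scalar_curvature g S r ->
  orthonormal_at p E -> r p = \sum_i eps i * S (E i) (E i) p.
Proof.
move=> sc oE; rewrite (sc p E (orthonormal_frame oE)).
pose J : 'M[R]_n := diag_mx (\row_i eps i).
have JJ : J *m J = 1%:M.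
  apply/matrixP => i j; rewrite mul_diag_mx !mxE.
  by case: eqP => [->|_]; rewrite ?mulr0 // lorentz_sign_sqr.
have -> : \matrix_(i, j) << E i, E j >> p = J.
  apply/matrixP => i j; rewrite !mxE oE.
  by case: eqP => [->|_]; rewrite ?mulr1n ?mulr0n.
have -> : invmx J = J.
  have [uJ _] := mulmx1_unit JJ.
  by rewrite -[RHS]mul1mx -(mulVmx uJ) -mulmxA JJ mulmx1.
by apply: eq_bigr => i _; rewrite mul_diag_mx !mxE.
Qed.

End Frames.

Section AdaptedFrame.
Context {R : realType} {m : nat} {M : manifold R m.+1} (g : lorentz_metric M).
Implicit Types (f h : Cinf M) (X Y Z V W : vfield M).
Local Notation "<< X , Y >>" := (inner g X Y).

Lemma lorentz_sign0 : lorentz_sign (ord0 : 'I_m.+1) = -1 :> R.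
Proof. by []. Qed.

Lemma lorentz_sign_lift (i : 'I_m) : lorentz_sign (lift ord0 i) = 1 :> R.
Proof. by []. Qed.

(* Reflecting [E] in the vector [N] exchanges [xi] and [s *: E 0], where the
   sign [s] is chosen so that [N] is not null. *)
Lemma adapted_frame_exists p xi : << xi, xi >> p = -1 ->
  exists2 E, orthonormal_at g p E & E ord0 = xi.
Proof.
move=> xi1; have [E [_ oE]] := orthonormal_frame_exists g p.
have addE (f h : Cinf M) : (f + h) p = f p + h p by [].
have mulE (f h : Cinf M) : (f * h) p = f p * h p by [].
have cstE (a : R) : (a *: (1 : Cinf M)) p = a by exact: mulr1.
have oE00 : << E ord0, E ord0 >> p = -1 by rewrite oE.
have [s s2 sq] : exists2 s : R, s * s = 1 & 1 + s * << E ord0, xi >> p != 0.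
  have [e|e] := eqVneq (1 + << E ord0, xi >> p) 0.
    by exists (-1); [lra|rewrite mulN1r; apply/eqP => e'; move: e e'; lra].
  by exists 1; rewrite ?mul1r.
pose N := xi + (- s *: (1 : Cinf M)) *: E ord0.
pose q := 1 + s * << E ord0, xi >> p.
(* The reflection [X - 2 <<X, N>> / <<N, N>> N], since [<<N, N>>] is [- 2 * q] at [p]. *)
pose rho X := X + ((q^-1 *: (1 : Cinf M)) * << X, N >>) *: N.
have NE X : << X, N >> p = << X, xi >> p - s * << X, E ord0 >> p.
  by rewrite /N innerDr innerZr addE mulE cstE mulNr.
have NN : << N, N >> p = - 2 * q.
  rewrite NE 2!(innerC g N) !NE xi1 oE00 (innerC g xi) /q.
  by have := s2; set a := << _, _ >> p; nra.
have rhoE X Y : << rho X, Y >> p =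
    << X, Y >> p + q^-1 * << X, N >> p * << N, Y >> p.
  by rewrite /rho innerDl innerZl addE !mulE cstE.
have rho_isom X Y : << rho X, rho Y >> p = << X, Y >> p.
  rewrite rhoE (innerC g X) (innerC g N) !rhoE NN (innerC g N X).
  rewrite (innerC g Y X); field.
  exact: sq.
have rho0 X : << rho (E ord0), X >> p = s * << xi, X >> p.
  rewrite rhoE NE oE00 (innerC g N) NE.
  have -> : << E ord0, xi >> p - s * -1 = s * q.
    by rewrite /q mulrDr mulrA s2 mul1r mulr1 mulrN1 opprK addrC.
  rewrite [_^-1 * _]mulrCA mulVf // mulr1 (innerC g X (E _)) (innerC g X).
  by rewrite mulrBr mulrA s2 mul1r addrC subrK.
(* At [p] the value of [rho (E ord0)] is that of [s *: xi]. Taking [xi] itself makes [F ord0 = xi]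
   an equation of vector fields. *)
pose F i := if i == ord0 then xi else rho (E i).
have FE i : i != ord0 -> F i = rho (E i) by rewrite /F => /negPf ->.
have F0i i : i != ord0 -> << F ord0, F i >> p = 0.
  move=> i0; have := rho0 (rho (E i)).
  rewrite rho_isom oE eq_sym (negPf i0) (FE i) // => /esym/eqP.
  by rewrite mulf_eq0 => /orP[/eqP s0|/eqP //]; move: s2; rewrite s0; lra.
exists F => // i j.
case: (altP (i =P ord0)) => [->|i0]; case: (altP (j =P ord0)) => [->|j0].
- by rewrite eqxx xi1.
- by rewrite F0i // eq_sym (negPf j0).
- by rewrite innerC F0i // (negPf i0).
- by rewrite !FE // rho_isom oE.
Qed.

End AdaptedFrame.

(** * The curvature of a perfect fluid with torse-forming velocity *)

Lemma ord3_cases (i : 'I_3) : [\/ i = inord 0, i = inord 1 | i = inord 2].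
Proof.
case: i => [[|[|[|//]]] lti].
- by apply: Or31; apply: val_inj; rewrite /= inordK.
- by apply: Or32; apply: val_inj; rewrite /= inordK.
- by apply: Or33; apply: val_inj; rewrite /= inordK.
Qed.

(** Two pairs of distinct indices among three share an index, so up to sign every component is some
    [T i j k i]. For [j] and [k] distinct it is the only surviving term of a trace; for [j = k] the
    traces say that the three sectional curvatures have pairwise sums 0. *)
Lemma ricci_flat3 (R : realFieldType) (T : 'I_3 -> 'I_3 -> 'I_3 -> 'I_3 -> R) :
  (forall i j k l, T j i k l = - T i j k l) ->
  (forall i j k l, T i j l k = - T i j k l) ->
  (forall j k, \sum_i T i j k i = 0) ->
  forall i j k l, T i j k l = 0.
Proof.
move=> anti12 anti34 ric.
have {}ric j k : T (inord 0) j k (inord 0) + T (inord 1) j k (inord 1)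
    + T (inord 2) j k (inord 2) = 0.
  rewrite -[RHS](ric j k) !big_ord_recl big_ord0 addr0 addrA.
  by congr (T _ _ _ _ + T _ _ _ _ + T _ _ _ _); apply: val_inj;
    rewrite /= inordK.
have d i k l : T i i k l = 0 by have := anti12 i i k l; lra.
have d' i j k : T i j k k = 0 by have := anti34 i j k k; lra.
have K i j : T j i i j = T i j j i by rewrite anti12 anti34 opprK.
have Z i j k : T i j k i = 0.
  have r00 := ric (inord 0) (inord 0); have r11 := ric (inord 1) (inord 1).
  have r22 := ric (inord 2) (inord 2); rewrite !d in r00 r11 r22.
  rewrite (K (inord 0) (inord 1)) in r00.
  rewrite (K (inord 0) (inord 2)) (K (inord 1) (inord 2)) in r00 r11.
  have rjk := ric j k.
  case: (ord3_cases i) (ord3_cases j) (ord3_cases k) rjk =>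
    -> [] -> [] ->; rewrite ?d ?d' //;
    rewrite ?(K (inord 0)) ?(K (inord 1) (inord 2)); lra.
move=> i j k l.
have [->|ij] := eqVneq i j; first exact: d.
have [->|kl] := eqVneq k l; first exact: d'.
have [->|il] := eqVneq i l; first exact: Z.
have [->|ik] := eqVneq i k; first by rewrite anti34 Z oppr0.
have [->|jl] := eqVneq j l; first by rewrite anti12 Z oppr0.
have [->|jk] := eqVneq j k; first by rewrite anti12 anti34 Z !oppr0.
(* Four pairwise distinct indices would remain in ['I_3]. *)
exfalso; move: i j k l ij kl il ik jl jk.
by do 4![case=> [[|[|[|//]]] ?]].
Qed.

Section TorseForming.
Context {R : realType} {n : nat} {M : manifold R n} (g : lorentz_metric M).
Variable D : vfield M -> vfield M -> vfield M.
Hypothesis D_levi_civita : is_levi_civita g D.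
Variable xi : vfield M.
Hypothesis xi_unit : unit_timelike g xi.
Hypothesis xi_torse_forming : torse_forming g D xi.
Implicit Types (f h : Cinf M) (X Y Z V W : vfield M).
Local Notation "<< X , Y >>" := (inner g X Y).
Local Notation Rm X Y Z W := << curvature D X Y Z, W >>.
Local Notation eta X := << X, xi >>.

(* The metric of the orthogonal complement of [xi], zero along [xi]. *)
Definition screen X Y : Cinf M := << X, Y >> + eta X * eta Y.
Local Notation P := screen.

Lemma screenE X Y : P X Y = << X, Y >> + eta X * eta Y.
Proof. by []. Qed.

Lemma inner_xi : << xi, xi >> = -1.
Proof. exact: Cinf_eq. Qed.

Lemma conn_xi X : D X xi = X + eta X *: xi.
Proof. exact: xi_torse_forming. Qed.

(** Here [P] appears as the covariant derivative of the 1-form [eta]. *)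
Lemma conn_eta X Y : X (eta Y) = eta (D X Y) + P X Y.
Proof.
rewrite (conn_metric D_levi_civita) conn_xi innerDr innerZr screenE.
rewrite (innerC g Y X).
by ring.
Qed.

Lemma curvature_xi3 X Y W :
  Rm X Y xi W = eta Y * << X, W >> - eta X * << Y, W >>.
Proof.
rewrite curvatureE !conn_xi !(connDr D_levi_civita, connZr D_levi_civita).
rewrite !conn_eta !conn_xi (torsion_free D_levi_civita) !innerE !screenE.
rewrite (innerC g Y X); ring.
Qed.

Lemma curvature_xi1 X Y W :
  Rm xi X Y W = << X, Y >> * eta W - eta Y * << X, W >>.
Proof.
rewrite (curvature_pair D_levi_civita) curvature_xi3.
rewrite (innerC g W X) (innerC g Y X).
by ring.
Qed.

Lemma curvature_xi1_vfield X Y :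
  curvature D xi X Y = << X, Y >> *: xi - eta Y *: X.
Proof.
apply: (inner_nondegenerate (g := g)) => W.
by rewrite curvature_xi1 !innerE (innerC g xi).
Qed.

(** In the trace of [curvature_xi3] one term counts the dimension, and the other is the frame
    expansion of [eta Y]. *)
Lemma ricci_xi S p Y : is_ricci D S -> S Y xi p = (n%:R - 1) * eta Y p.
Proof.
have [E [fE oE]] := orthonormal_frame_exists g p.
move=> /ricci_orthonormal-/(_ _ _ _ _ _ oE) ->.
transitivity (\sum_(i < n)
    (eta Y p - lorentz_sign i * << Y, E i >> p * << xi, E i >> p)).
  apply: eq_bigr => i _; rewrite curvature_xi3 !CinfE oE eqxx mulrBr mulrCA.
  by rewrite lorentz_sign_sqr mulr1 (innerC g xi (E i)); ring.
rewrite sumrB sumr_const card_ord mulrBl mul1r mulr_natl; congr (_ - _).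
by rewrite (inner_expansion Y xi fE oE).
Qed.

End TorseForming.

Opaque inner curvature screen.

Section PerfectFluid.
Context {R : realType} {M : manifold R 4} (g : lorentz_metric M).
Variable D : vfield M -> vfield M -> vfield M.
Hypothesis D_levi_civita : is_levi_civita g D.
Variable xi : vfield M.
Hypothesis xi_unit : unit_timelike g xi.
Hypothesis xi_torse_forming : torse_forming g D xi.
Variable k : Cinf M.
Implicit Types (f h : Cinf M) (X Y Z V W : vfield M).
Local Notation "<< X , Y >>" := (inner g X Y).
Local Notation Rm X Y Z W := << curvature D X Y Z, W >>.
Local Notation eta X := << X, xi >>.
Local Notation P := (screen g xi).
Local Notation eps := (@lorentz_sign R 4).

(* In terms of the frame trace, the Ricci tensor is
   [(3 + 2 * k) * g + 2 * k * eta * eta]. *)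
Hypothesis ricci_k : forall p (E : 'I_4 -> vfield M), orthonormal_at g p E ->
  forall Y Z, \sum_i eps i * Rm (E i) Y Z (E i) p =
    (3 + 2 * k p) * << Y, Z >> p + 2 * k p * eta Y p * eta Z p.

(** Both sides have the same symmetries, the same values when an argument is [xi], and the same
    Ricci trace. Their difference lives on the positive definite complement of [xi], where
    [ricci_flat3] applies. *)
Lemma curvature_form X Y Z W :
  Rm X Y Z W = << Y, Z >> * << X, W >> - << X, Z >> * << Y, W >>
    + k * (P Y Z * P X W - P X Z * P Y W).
Proof.
(* [Q] is the difference of the two sides. By the pair symmetry each of its
   slots can be moved to the last one, where it is clearly pointwise, so it can
   be evaluated on a frame at a point without extending tangent vectors. *)
have [Q QE] : exists Q, forall X Y Z W, << Q X Y Z, W >> =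
    Rm X Y Z W - (<< Y, Z >> * << X, W >> - << X, Z >> * << Y, W >>)
    - k * (P Y Z * P X W - P X Z * P Y W).
  (* Pairing [project X] with [W] gives [P X W]. *)
  pose project X := X + eta X *: xi.
  exists (fun X Y Z =>
    curvature D X Y Z - (<< Y, Z >> *: X - << X, Z >> *: Y)
      - k *: (P Y Z *: project X - P X Z *: project Y)) => X' Y' Z' W'.
  rewrite /project !screenE !innerE (innerC g xi); ring.
have Q12 X' Y' Z' W' : << Q Y' X' Z', W' >> = - << Q X' Y' Z', W' >>.
  by rewrite !QE (curvature_anti12 D_levi_civita X' Y'); ring.
have Q34 X' Y' Z' W' : << Q X' Y' W', Z' >> = - << Q X' Y' Z', W' >>.
  by rewrite !QE (curvature_anti34 D_levi_civita X' Y' Z'); ring.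
have Qpair X' Y' Z' W' : << Q X' Y' Z', W' >> = << Q Z' W' X', Y' >>.
  rewrite !QE (curvature_pair D_levi_civita X' Y') !screenE.
  rewrite (innerC g Z' X') (innerC g Z' Y') (innerC g W' X') (innerC g W' Y').
  by ring.
have Qxi X' Y' Z' : << Q xi X' Y', Z' >> = 0.
  rewrite QE (curvature_xi1 D_levi_civita xi_torse_forming) !screenE.
  by rewrite (inner_xi xi_unit) (innerC g xi Y') (innerC g xi Z'); ring.
suff Q0 : << Q X Y Z, W >> = 0.
  by apply/eqP; rewrite -subr_eq0 opprD addrA -QE; apply/eqP.
apply: Cinf_eq => p; have [E oE E0] := adapted_frame_exists (xi_unit p).
have fE := orthonormal_frame oE.
have eE i : eta (E (lift ord0 i)) p = 0 by rewrite -E0 oE.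
have EE i : << E (lift ord0 i), E (lift ord0 i) >> p = 1 by rewrite oE eqxx.
(* The trace runs over the spatial vectors only: [curvature_xi1] gives the [xi] term of [ricci_k],
   and [inner_expansion] sums the products of [Y'] and [Z'] with the frame. *)
have ricQ Y' Z' : \sum_i << Q (E (lift ord0 i)) Y' Z', E (lift ord0 i) >> p = 0.
  have := ricci_k oE Y' Z'; have := inner_expansion Y' Z' fE oE.
  rewrite !big_ord_recl !big_ord0 !addr0 !QE !screenE !CinfE !eE !EE !E0.
  rewrite (curvature_xi1 D_levi_civita xi_torse_forming) !CinfE.
  rewrite !(innerC g Y' (E _)) !(innerC g _ Z') (inner_xi xi_unit) !CinfE.
  rewrite lorentz_sign0 !lorentz_sign_lift => -> /eqP; rewrite -subr_eq0.
  by move=> /eqP ric; apply: etrans ric; ring.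
have red4 X' Y' Z' W' : (forall l, << Q X' Y' Z', E l >> p = 0) ->
    << Q X' Y' Z', W' >> p = 0.
  move=> q0; rewrite (inner_expansion _ _ fE oE) big1 // => l _.
  by rewrite q0 mulr0 mul0r.
have red3 X' Y' Z' W' : (forall l, << Q X' Y' (E l), W' >> p = 0) ->
    << Q X' Y' Z', W' >> p = 0.
  move=> q0; rewrite Q34 CinfE red4 ?oppr0 // => l.
  by rewrite Q34 CinfE q0 oppr0.
transitivity (0 : R); last by [].
apply: (red4) => l; apply: (red3) => k'; rewrite Qpair.
apply: (red4) => j; apply: (red3) => i; rewrite Qpair.
(* An index 0 puts [xi] in some slot, and the symmetries of [Q] bring it to the first one. *)
have [i'|] := unliftP ord0 i; last first.
  by move=> ->; rewrite E0 Qxi.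
have [j'|] := unliftP ord0 j; last first.
  by move=> -> _; rewrite Q12 E0 Qxi CinfE oppr0.
have [k''|] := unliftP ord0 k'; last first.
  by move=> -> _ _; rewrite Qpair E0 Qxi.
have [l'|] := unliftP ord0 l; last first.
  by move=> -> _ _ _; rewrite Qpair Q12 E0 Qxi CinfE oppr0.
move=> -> -> -> ->.
pose T a b c d : R := << Q (E (lift ord0 a)) (E (lift ord0 b))
  (E (lift ord0 c)), E (lift ord0 d) >> p.
apply: (@ricci_flat3 R T) => [a b c d|a b c d|b c].
- by rewrite /T Q12.
- by rewrite /T Q34.
- exact: ricQ.
Qed.

End PerfectFluid.

(** * The soliton equation *)

Section ScreenCurvature.
Context {R : realType} {M : manifold R 4} (g : lorentz_metric M).
Variable D : vfield M -> vfield M -> vfield M.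
Hypothesis D_levi_civita : is_levi_civita g D.
Variable xi : vfield M.
Hypothesis xi_unit : unit_timelike g xi.
Hypothesis xi_torse_forming : torse_forming g D xi.
Variable k : Cinf M.
Implicit Types (f h : Cinf M) (X Y Z V W : vfield M).
Local Notation "<< X , Y >>" := (inner g X Y).
Local Notation Rm X Y Z W := << curvature D X Y Z, W >>.
Local Notation eta X := << X, xi >>.
Local Notation P := (screen g xi).

Hypothesis curvature_k : forall X Y Z W,
  Rm X Y Z W = << Y, Z >> * << X, W >> - << X, Z >> * << Y, W >>
    + k * (P Y Z * P X W - P X Z * P Y W).

Let conn_curvature X Y Z W V :
  << D V (curvature D X Y Z), W >> = V (Rm X Y Z W) - Rm X Y Z (D V W).
Proof. by rewrite (conn_metric D_levi_civita) addrK. Qed.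

(** Evaluation on spatial frame vectors removes the factors [P] from the tensor identities below. *)
Lemma screen_adapted p (E : 'I_4 -> vfield M) : orthonormal_at g p E ->
  E ord0 = xi -> forall i j, << E (lift ord0 i), E (lift ord0 j) >> p +
    eta (E (lift ord0 i)) p * eta (E (lift ord0 j)) p = (i == j)%:R.
Proof.
move=> oE E0 i j; rewrite -E0 !oE mul0r addr0.
by rewrite (inj_eq lift_inj) lorentz_sign_lift; case: eqP.
Qed.

(** In the second Bianchi identity for [xi], [X], [Y], the derivative along [xi] contributes [xi k],
    as [P] is parallel along [xi]. The other two contribute [k] each: the [P] part of the curvature
    vanishes on [xi], and [D X xi] is [X] up to a multiple of [xi]. *)
Lemma deriv_screen_curvature : xi k = - (2 * k).
Proof.
have key X Y Z W :
    (xi k + 2 * k) * (P Y Z * P X W - P X Z * P Y W) = 0.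
  have := bianchi2 D_levi_civita xi X Y Z W.
  rewrite !conn_curvature !curvature_k !(torsion_free D_levi_civita) !screenE.
  rewrite !(vfieldD, vfieldN, vfieldM) !(conn_metric D_levi_civita).
  rewrite !(conn_xi xi_torse_forming) !innerE !(inner_xi xi_unit).
  rewrite !(innerC g _ xi) !(innerC g _ X) !(innerC g _ Y) !(innerC g _ Z).
  rewrite !(innerC g _ W) => /eqP; rewrite -subr_eq0 => /eqP e.
  by apply: etrans e; ring.
apply: Cinf_eq => p; have [E oE E0] := adapted_frame_exists (xi_unit p).
(* For two distinct spatial frame vectors the factor made of [P] is 1. *)
have := key (E (lift ord0 ord0)) (E (lift ord0 ord_max)).
move=> /(_ (E (lift ord0 ord_max)) (E (lift ord0 ord0))).
move=> /(congr1 (fun f : Cinf M => f p)).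
rewrite !CinfE !(screen_adapted oE E0) !eqxx /=.
by move: (xi k p) (k p) => a b; lra.
Qed.

(** [c] will be the constant function [3 + Lam]; its constancy enters through vanishing derivatives,
    so that all identities stay in the ring [Cinf M]. *)
Variables (V : vfield M) (c : Cinf M).
Hypothesis deriv_c : forall X, X c = 0.
Hypothesis lie_metric_k : forall X Y,
  << D X V, Y >> + << X, D Y V >> =
    - (2 * (2 * k + c) * << X, Y >>) - 4 * k * eta X * eta Y.
Local Notation f := (eta V).

Let lie_bracket_conn X Y h : X (Y h) = Y (X h) + (D X Y) h - (D Y X) h.
Proof.
rewrite -addrA -[_ - _]/((D X Y - D Y X) h) -(torsion_free D_levi_civita).
by rewrite lie_bracketE addrC subrK.
Qed.

(** The soliton equation at [(xi, xi)], where the terms in [k] cancel; [xi] is geodesic. *)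
Let deriv_f : xi f = c.
Proof.
have := lie_metric_k xi xi; rewrite (innerC g xi (D _ _)) => e.
rewrite (conn_metric D_levi_civita) (conn_xi xi_torse_forming).
rewrite (inner_xi xi_unit).
rewrite scaleN1r subrr (innerC g V 0) inner0l addr0.
apply/eqP; rewrite -subr_eq0; apply/eqP/Cinf_double_eq0.
rewrite addrACA e (inner_xi xi_unit); ring.
Qed.

(** The soliton equation at [(X, xi)]. It expresses [D xi V] through [V] and the differential of
    [f]. *)
Let inner_conn_xi_V X :
  << D xi V, X >> = - (2 * c * eta X) - X f + << V, X >> + eta X * f.
Proof.
have := lie_metric_k X xi; rewrite (inner_xi xi_unit) => e.
rewrite (conn_metric D_levi_civita X) (conn_xi xi_torse_forming).
rewrite innerDr innerZr.
rewrite (innerC g _ X); set a := << X, D xi V >> in e *.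
have -> : a = << D X V, xi >> + a - << D X V, xi >> by ring.
rewrite e; ring.
Qed.

(** In the derivative of the soliton equation along [xi], the curvature and [inner_conn_xi_V] trade
    the second derivatives of [V] for those of [f]. By symmetry the Hessian of [f] appears twice. *)
Let hessian X Y : X (Y f) - (D X Y) f =
  (2 * xi k - 2 * c) * P X Y + 2 * c * eta X * eta Y
    + X f * eta Y + eta X * Y f.
Proof.
(* The name [F] keeps [conn_metric] from expanding the derivatives of [f], which are the
   unknowns. *)
have [F FE] : {F | F = f} by exists f.
have U A B : << D A (D xi V), B >> = A << D xi V, B >> - << D xi V, D A B >>.
  by rewrite (conn_metric D_levi_civita) addrK.
(* Commutes [D xi] with [D A], using [[xi, A] = D xi A - A - eta A *: xi]. *)
have Rx A B : << D xi (D A V), B >> = Rm xi A V B + << D A (D xi V), B >>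
    + << D (D xi A) V, B >> - << D A V, B >> - eta A * << D xi V, B >>.
  rewrite curvatureE (torsion_free D_levi_civita) (conn_xi xi_torse_forming).
  rewrite !(connDl D_levi_civita, connNl D_levi_civita, connZl D_levi_civita).
  by rewrite !innerE; ring.
(* The soliton equation, used to exchange the arguments of [<<D A V, B>>]. *)
have h A B : << D A V, B >> =
    - (2 * (2 * k + c) * << A, B >>) - 4 * k * eta A * eta B - << D B V, A >>.
  by rewrite -lie_metric_k (innerC g A) addrK.
rewrite -FE; have := congr1 xi (lie_metric_k X Y).
rewrite vfieldD !(conn_metric D_levi_civita) (innerC g X (D xi (D Y V))).
rewrite (innerC g (D xi X)) !Rx !(curvature_xi1 D_levi_civita xi_torse_forming).
rewrite !U !inner_conn_xi_V (h (D xi X)) (h (D xi Y)) -!FE.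
rewrite !(vfieldD, vfieldN, vfieldM, vfield_nat, deriv_c).
rewrite (lie_bracket_conn Y X).
rewrite !(conn_metric D_levi_civita) !(conn_xi xi_torse_forming) !innerE.
rewrite !(h Y X) (inner_xi xi_unit) !screenE.
rewrite !(innerC g _ xi) !(innerC g _ V) !(innerC g _ X) !(innerC g _ Y).
move=> /eqP; rewrite -subr_eq0 => /eqP e.
apply/eqP; rewrite -subr_eq0; apply/eqP/Cinf_double_eq0/eqP.
rewrite -oppr_eq0; apply/eqP/(etrans _ e); ring.
Qed.

(** The third derivatives of [f] along [xi], [X], [Y], taken in two orders, differ by the curvature.
    All are known from the Hessian; with [xi k = - (2 * k)] the terms in [k] cancel and
    [c * P X Y = 0] remains. *)
Lemma lie_metric_const_eq0 : c = 0.
Proof.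
have [F FE] : {F | F = f} by exists f.
have H (A B : vfield M) : A (B F) = (D A B) F
    + ((- (4 * k) - 2 * c) * (<< A, B >> + eta A * eta B)
    + 2 * c * eta A * eta B + A F * eta B + eta A * B F).
  have := hessian A B; rewrite -FE deriv_screen_curvature screenE => /eqP.
  by rewrite subr_eq => /eqP ->; ring.
have xiF : xi F = c by rewrite FE deriv_f.
(* The term in [k] is absent here because [P] vanishes on [xi]. *)
have Hxi (B : vfield M) : xi (B F) = (D xi B) F - c * eta B - B F.
  by rewrite H xiF (inner_xi xi_unit) (innerC g xi B); ring.
have key X Y : c * P X Y = 0.
  have := congr1 xi (H X Y).
  rewrite (lie_bracket_conn xi X) (conn_xi xi_torse_forming) add_vfieldE.
  rewrite scale_vfieldE !Hxi !(vfieldD, vfieldN, vfieldM, vfield_nat, deriv_c).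
  rewrite !Hxi !H deriv_screen_curvature !screenE.
  rewrite !(conn_metric D_levi_civita) !(conn_xi xi_torse_forming) !innerE
    (inner_xi xi_unit).
  have : curvature D xi X Y F = (<< X, Y >> *: xi - eta Y *: X) F.
    by rewrite (curvature_xi1_vfield D_levi_civita xi_torse_forming).
  rewrite curvature_vfieldE (torsion_free D_levi_civita).
  rewrite (conn_xi xi_torse_forming).
  rewrite !(connDl D_levi_civita, connNl D_levi_civita, connZl D_levi_civita).
  rewrite !(add_vfieldE, opp_vfieldE, scale_vfieldE) xiF.
  rewrite !(innerC g _ xi) !(innerC g _ X) !(innerC g _ Y).
  move=> /eqP; rewrite -subr_eq0 => /eqP C.
  move=> /eqP; rewrite -subr_eq0 => /eqP e.
  by apply/Cinf_double_eq0/(etrans _ (etrans (congr2 +%R e C) (addr0 _))); ring.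
apply: Cinf_eq => p; have [E oE E0] := adapted_frame_exists (xi_unit p).
have := key (E (lift ord0 ord0)) (E (lift ord0 ord0)).
move=> /(congr1 (fun h : Cinf M => h p)).
by rewrite !CinfE !(screen_adapted oE E0) eqxx mulr1.
Qed.

End ScreenCurvature.

Theorem theorem13 (R : realType) (M : manifold R 4)
    (M_connected : connected [set: M])
    (g : lorentz_metric M)
    (nabla : vfield M -> vfield M -> vfield M)
    (nabla_levi_civita : is_levi_civita g nabla)
    (S : vfield M -> vfield M -> M -> R) (S_ricci : is_ricci nabla S)
    (r : M -> R) (r_scalar : is_scalar_curvature g S r)
    (xi : vfield M) (xi_unit : unit_timelike g xi)
    (lambda kappa : R) (sigma rho : Cinf M)
    (einstein : einstein_equation g S r lambda kappa
                  (energy_momentum g xi sigma rho))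
    (xi_torse_forming : torse_forming g nabla xi)
    (V : vfield M) (Lam : R) (soliton : ricci_soliton g S V Lam) :
  ((forall p, assoc_a lambda kappa sigma rho p = assoc_b kappa sigma rho p) /\
   (forall X Y p, S X Y p = kappa * (sigma p + rho p) *
      (inner g X Y p + dual_form g xi X p * dual_form g xi Y p)) /\
   ~ steady Lam)
  \/
  ((expanding Lam \/ shrinking Lam) /\
   forall p,
     (expanding Lam <-> kappa * (sigma p + 3 * rho p) / 2 > lambda) /\
     (shrinking Lam <-> kappa * (sigma p + 3 * rho p) / 2 < lambda)).
Proof.
have [k kE] : {k : Cinf M | forall p, k p = kappa * (sigma p + rho p) / 2}.
  by exists ((kappa / 2) *: (sigma + rho)) => p; rewrite !CinfE mulrAC.
have S_xi p : S xi xi p = -3.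
  rewrite (ricci_xi nabla_levi_civita xi_torse_forming _ _ S_ricci) xi_unit.
  by lra.
have SE X Y p : S X Y p = (3 + 2 * k p) * inner g X Y p
    + 2 * k p * inner g X xi p * inner g Y xi p.
  have := einstein xi xi p; have := einstein X Y p.
  rewrite /energy_momentum /dual_form S_xi xi_unit kE.
  set a := inner g X Y p; set b := inner g X xi p; set c := inner g Y xi p.
  move=> e1 e2; apply: (addIr ((lambda - r p / 2) * a)); rewrite e1.
  (* Einstein's equation at [(xi, xi)], where the energy-momentum tensor equals [sigma]. *)
  have -> : lambda - r p / 2 = - 3 - kappa * sigma p by lra.
  by field.
(* The trace of [SE]: four times [3 + 2 * k], and [- 2 * k] from [eta] squared. *)
have rE p : r p = 12 + 6 * k p.
  have [E [fE oE]] := orthonormal_frame_exists g p.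
  rewrite (scalar_curvature_orthonormal r_scalar oE).
  have := inner_expansion xi xi fE oE; rewrite xi_unit => xi2.
  transitivity (\sum_(i < 4) (3 + 2 * k p + 2 * k p *
      (lorentz_sign i * inner g xi (E i) p * inner g xi (E i) p))).
    apply: eq_bigr => i _; rewrite SE oE eqxx (innerC g (E i)) mulrDr mulrCA.
    by rewrite lorentz_sign_sqr; ring.
  by rewrite big_split /= -mulr_sumr -xi2 sumr_const card_ord; ring.
have lambdaE p : lambda = 3 + kappa * (sigma p + 3 * rho p) / 2.
  have := einstein xi xi p.
  by rewrite /energy_momentum /dual_form S_xi xi_unit rE kE; lra.
have curvature_k := curvature_form nabla_levi_civita xi_unit xi_torse_forming
  (k := k).
have {}curvature_k := curvature_k (fun p E oE Y Z =>
  etrans (esym (ricci_orthonormal Y Z S_ricci oE)) (SE Y Z p)).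
have Lam3 : Lam = -3.
  have [p _] := manifold_nonempty M.
  have := lie_metric_const_eq0 nabla_levi_civita xi_unit xi_torse_forming
    curvature_k (V := V) (c := (3 + Lam) *: (1 : Cinf M)).
  move=> /(_ (fun X => vfield_cst X _)) H.
  have /(congr1 (fun f : Cinf M => f p)) : (3 + Lam) *: (1 : Cinf M) = 0.
    apply: H => X Y; apply: Cinf_eq => q.
    rewrite -(lie_metricE nabla_levi_civita); have := soliton X Y q.
    by rewrite SE !CinfE; lra.
  by rewrite !CinfE; lra.
(* The soliton is shrinking, and by [lambdaE] the value of [lambda] exceeds the other side of the
   comparison by 3 at every point. *)
right; rewrite /expanding /shrinking Lam3; split; first by right; lra.
by move=> p; rewrite (lambdaE p); split; split; lra.
Qed.
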